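(* Let $(X,\to,{}^*,1)$ be an involutive BE algebra. Then the condition (QW) $x\to ((x\wedge y)\wedge (z\wedge x))=(x\to y)\wedge (x\to z)$ for all $x,y,z\in X$ holds if and only if both of the following conditions hold: (QW$_1$) $x\to (x\wedge y)=x\to y$ for all $x,y\in X$; (QW$_2$) $x\to (y\wedge (z\wedge x))=(x\to y)\wedge (x\to z)$ for all $x,y,z\in X$.
   Context: A BE algebra is an algebra $(X,\to,1)$ of type $(2,0)$ such that for all $x,y,z\in X$: $x\to x=1$; $x\to 1=1$; $1\to x=x$; $x\to(y\to z)=y\to(x\to z)$. Write $x\le y$ iff $x\to y=1$ (in general $\le$ is not a partial order). It is bounded if there is $0\in X$ with $0\le x$ for all $x$; then $x^*:=x\to 0$. A bounded BE algebra is involutive if $x^{**}=x$ for all $x$; it is then written $(X,\to,{}^*,1)$, with $0=1^*$. In an involutive BE algebra put $x\vee y:=(x\to y)\to y$ and $x\wedge y:=(x^*\vee y^* )^*=((x^*\to y^* )\to y^* )^*$. *)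

(* Defs.v *)
Declare Scope be_scope.
Delimit Scope be_scope with BE.

Record BEAlgebra : Type := {
  carrier :> Type;
  imp : carrier -> carrier -> carrier;
  one : carrier;
  imp_diag : forall x, imp x x = one;
  imp_one : forall x, imp x one = one;
  one_imp : forall x, imp one x = x;
  imp_exchange : forall x y z, imp x (imp y z) = imp y (imp x z)
}.

Arguments imp {_} _ _.
Arguments one {_}.

Notation "x ~> y" := (imp x y) (at level 55, right associativity) : be_scope.
Notation "1" := one : be_scope.
Local Open Scope be_scope.

Definition le {X : BEAlgebra} (x y : X) : Prop := x ~> y = 1.

(* [le] is not antisymmetric in general, so a least element need not be
   unique; the bottom element is therefore part of the structure. *)
Record BoundedBEAlgebra : Type := {
  bounded_be :> BEAlgebra;
  zero : bounded_be;
  zero_le : forall x : bounded_be, le zero x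
}.

Arguments zero {_}.

Notation "0" := zero : be_scope.

Definition star {X : BoundedBEAlgebra} (x : X) : X := x ~> 0.

Notation "x ^*" := (star x) (at level 2, format "x ^*") : be_scope.

Record InvolutiveBEAlgebra : Type := {
  involutive_bounded :> BoundedBEAlgebra;
  star_star : forall x : involutive_bounded, x^*^* = x
}.

Definition join {X : InvolutiveBEAlgebra} (x y : X) : X := (x ~> y) ~> y.

Notation "x ⊔ y" := (join x y) (at level 50, left associativity) : be_scope.

Definition meet {X : InvolutiveBEAlgebra} (x y : X) : X := (x^* ⊔ y^*)^*.

Notation "x ⊓ y" := (meet x y) (at level 40, left associativity) : be_scope.

(* The convention [0 = 1^*]. *)
Lemma star_one (X : BoundedBEAlgebra) : (1 : X)^* = 0.
Proof. exact (one_imp X 0). Qed.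

Definition QW (X : InvolutiveBEAlgebra) : Prop :=
  forall x y z : X, x ~> ((x ⊓ y) ⊓ (z ⊓ x)) = (x ~> y) ⊓ (x ~> z).

Definition QW1 (X : InvolutiveBEAlgebra) : Prop :=
  forall x y : X, x ~> (x ⊓ y) = x ~> y.

Definition QW2 (X : InvolutiveBEAlgebra) : Prop :=
  forall x y z : X, x ~> (y ⊓ (z ⊓ x)) = (x ~> y) ⊓ (x ~> z).

(* Main.v *)
(** By contraposition, [u ⊓ v] is the complement of [(v ~> u) ~> v^* ], so it
    depends on [u] only through [v ~> u].  Taking [y := 1] in (QW) gives
    [x ~> (z ⊓ x) = x ~> z], because [x ⊓ (z ⊓ x) = z ⊓ x]; then [z := 1] gives
    (QW1).  By (QW1), [(z ⊓ x) ~> (x ⊓ y) = (z ⊓ x) ~> y], so replacing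
    [x ⊓ y] by [y] does not change the left-hand side of (QW), which then
    becomes that of (QW2).  The converse is direct substitution. *)
Require Import Defs.
Local Open Scope be_scope.

Lemma imp_contra (X : InvolutiveBEAlgebra) (x y : X) : y^* ~> x^* = x ~> y.
Proof.
  (* Opening only [x^*] lets exchange turn [y^* ~> (x ~> 0)] into [x ~> (y^* ~> 0)]. *)
  unfold star at 2. rewrite imp_exchange.
  change (x ~> y^*^* = x ~> y). now rewrite star_star.
Qed.

Lemma meet_imp (X : InvolutiveBEAlgebra) (x y : X) :
  x ⊓ y = ((y ~> x) ~> y^*)^*.
Proof. unfold meet, join. now rewrite imp_contra. Qed.

Lemma star_meet (X : InvolutiveBEAlgebra) (x y : X) :
  (x ⊓ y)^* = (y ~> x) ~> y^*.
Proof. rewrite meet_imp. apply star_star. Qed.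

Lemma meet_one_r (X : InvolutiveBEAlgebra) (x : X) : x ⊓ 1 = x.
Proof.
  rewrite meet_imp, one_imp, star_one. apply star_star.
Qed.

Lemma meet_one_l (X : InvolutiveBEAlgebra) (x : X) : 1 ⊓ x = x.
Proof.
  rewrite meet_imp, imp_one, one_imp. apply star_star.
Qed.

Lemma meet_le_r (X : InvolutiveBEAlgebra) (x y : X) : le (x ⊓ y) y.
Proof.
  unfold le. rewrite <- imp_contra, star_meet, imp_exchange, imp_diag.
  apply imp_one.
Qed.

Lemma meet_of_le (X : InvolutiveBEAlgebra) (x y : X) : le y x -> x ⊓ y = y.
Proof.
  unfold le. intro H. rewrite meet_imp, H, one_imp. apply star_star.
Qed.

Lemma QW_imp_meet_r (X : InvolutiveBEAlgebra) :
  QW X -> forall x z : X, x ~> (z ⊓ x) = x ~> z.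
Proof.
  intros H x z. specialize (H x 1 z).
  rewrite meet_one_r, imp_one, meet_one_l in H.
  now rewrite (meet_of_le X x (z ⊓ x) (meet_le_r X z x)) in H.
Qed.

Lemma QW_QW1 (X : InvolutiveBEAlgebra) : QW X -> QW1 X.
Proof.
  intros H x y. pose proof (H x y 1) as Hxy.
  rewrite imp_one, meet_one_r, meet_one_l in Hxy.
  (* The left side is now [x ~> ((x ⊓ y) ⊓ x)], so the lemma applies with [x ⊓ y] as its [z]. *)
  now rewrite (QW_imp_meet_r X H) in Hxy.
Qed.

(** Contraposition and exchange give [(z ⊓ x) ~> w = (x ~> z) ~> (x ~> w)], so only [x ~> w]
    matters, and (QW1) equates it for [w := x ⊓ y] and [w := y]. *)
Lemma QW1_meet_imp_meet (X : InvolutiveBEAlgebra) :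
  QW1 X -> forall x y z : X, (z ⊓ x) ~> (x ⊓ y) = (z ⊓ x) ~> y.
Proof.
  intros H x y z.
  rewrite <- (imp_contra X (z ⊓ x) (x ⊓ y)), <- (imp_contra X (z ⊓ x) y).
  rewrite (star_meet X z x), (imp_exchange X (x ⊓ y)^*), (imp_exchange X y^*).
  now rewrite !imp_contra, H.
Qed.

Theorem theorem3p10 (X : InvolutiveBEAlgebra) : QW X <-> QW1 X /\ QW2 X.
Proof.
  split.
  - intro H. pose proof (QW_QW1 X H) as H1. split; [exact H1|].
    intros x y z. rewrite <- (H x y z).
    rewrite (meet_imp X y (z ⊓ x)), (meet_imp X (x ⊓ y) (z ⊓ x)).
    now rewrite (QW1_meet_imp_meet X H1).
  - intros [H1 H2] x y z. now rewrite H2, H1.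
Qed.
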